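(* Let $l\ge1$ be an integer and let $a_{l0}$ be real $N(0,C_l)$ and $a_{l1},\dots,a_{ll}$ complex Gaussian with independent real and imaginary parts each $N(0,C_l/2)$, all independent, with $C_l>0$; set $a_{l,-m}=(-1)^m\overline{a_{lm}}$ and $\hat C_l=\frac{1}{2l+1}\sum_{m=-l}^l|a_{lm}|^2$. For $0\le m\le l$ put $u_{lm}=a_{lm}/\sqrt{C_l}$ and $\hat u_{lm}=a_{lm}/\sqrt{\hat C_l}$. Let $1\le m_1<\dots<m_k\le l$ and let $q_0,q_1,q_1',\dots,q_k,q_k'$ be nonnegative integers with $q_0+\sum_{i=1}^k(q_i+q_i')=2p$ even. Then $$E\Big\{\hat u_{l0}^{q_0}\prod_{i=1}^k\hat u_{lm_i}^{q_i}\big(\overline{\hat u_{lm_i}}\big)^{q_i'}\Big\}=E\Big\{u_{l0}^{q_0}\prod_{i=1}^k u_{lm_i}^{q_i}\big(\overline{u_{lm_i}}\big)^{q_i'}\Big\}\,g(l;p),\qquad g(l;p)=\prod_{j=1}^p\frac{2l+1}{2l+2j-1}.$$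
   Context: $\overline{z}$ denotes complex conjugation. The variables $a_{lm}$ are the degree-$l$ spherical harmonic coefficients of a zero-mean isotropic Gaussian field with angular power spectrum $C_l$. *)

(* Defs.v *)
From HB Require Import structures.
From mathcomp Require Import all_boot all_order all_algebra.
From mathcomp Require Import all_classical all_reals all_analysis.
From mathcomp Require Import complex.
Set Implicit Arguments. Unset Strict Implicit. Unset Printing Implicit Defensive.
Import Order.TTheory GRing.Theory Num.Theory.
Import numFieldNormedType.Exports.
Local Open Scope classical_set_scope.
Local Open Scope ring_scope.

(* Mutual independence of a finite family of real random variables:
   measurability plus the product rule for all Borel sets.
   (Choosing B i = setT recovers the product rule for all subfamilies.) *)
Definition mutually_independent d (T : measurableType d) (R : realType)
  (P : probability T R) (I : finType) (F : I -> T -> R) : Prop :=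
  (forall i, measurable_fun setT (F i)) /\
  forall B : I -> set R, (forall i, measurable (B i)) ->
    P (\bigcap_(i in [set: I]) (F i @^-1` B i)) =
    (\prod_(i <- enum I) P (F i @^-1` B i))%E.

Definition is_centered_normal d (T : measurableType d) (R : realType)
  (P : probability T R) (v : R) (X : T -> R) : Prop :=
  measurable_fun setT X /\
  forall B : set R, measurable B ->
    P (X @^-1` B) = normal_prob 0 (Num.sqrt v) B.

Local Open Scope complex_scope.

Definition alm_pos {T} {R : realType} (X Y : nat -> T -> R) (m : nat) (t : T)
  : R[i] := if m == 0%N then (X 0%N t)%:C else X m t +i* Y m t.

Definition alm {T} {R : realType} (X Y : nat -> T -> R) (m : int) (t : T)
  : R[i] :=
  match m with
  | Posz n => alm_pos X Y n t
  | Negz n => (-1) ^+ n.+1 * (alm_pos X Y n.+1 t)^*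
  end.

Definition Chat {T} {R : realType} (l : nat) (X Y : nat -> T -> R) (t : T)
  : R :=
  ((2 * l + 1)%:R)^-1 *
  (\sum_(0 <= k < (2 * l + 1)%N) ComplexField.Normc.normc (alm X Y (k%:Z - l%:Z) t) ^+ 2)%R.

Definition moment_prod {T} {R : realType} (k : nat) (u : nat -> T -> R[i])
  (q0 : nat) (m q q' : 'I_k -> nat) (t : T) : R[i] :=
  u 0%N t ^+ q0 *
  \prod_(i < k) (u (m i) t ^+ q i * (u (m i) t)^* ^+ q' i).

Local Close Scope complex_scope.

Definition gfac {R : realType} (l p : nat) : R :=
  \prod_(1 <= j < p.+1) ((2 * l + 1)%:R / (2 * l + 2 * j - 1)%:R).

(* Main.v *)
(** The normalized field is unchanged by scaling the Gaussian vector, so the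
    claim is a statement about inverse moments of the squared radius: with
    [N = 2 l + 1] independent standard coordinates [Z], [S = |Z|^2] and [h]
    homogeneous of degree [2 p],
      [E(h(Z) / S^p) = E(h(Z)) / (N (N + 2) ... (N + 2 p - 2))].
    Instead of polar coordinates one uses the Laplace transform: the density of
    [Z] times [e^(-s S)] is again Gaussian, with coordinates shrunk by
    [(1 + 2 s)^(-1/2)], hence
      [E(h(Z) e^(-s S)) = (1 + 2 s)^(-(N + 2 p) / 2) E(h(Z))].
    Integrating [p] times over [s, oo), with Tonelli on the left, produces the
    factor [S^(-p)] and the constant.  Working separately with the positive and
    negative parts of [h], no integrability is ever needed. *)
Require Import Defs.
From HB Require Import structures.
From mathcomp Require Import all_boot all_order all_algebra.
From mathcomp Require Import all_classical all_reals all_analysis.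
From mathcomp Require Import measurable_realfun.
From mathcomp Require Import complex.
From mathcomp Require Import ring lra zify.
Set Implicit Arguments. Unset Strict Implicit. Unset Printing Implicit Defensive.
Import Order.TTheory GRing.Theory Num.Theory.
Import numFieldNormedType.Exports.
Local Open Scope classical_set_scope.
Local Open Scope ring_scope.

(** * Measures with a density, and image measures *)

Section weighted_measure.
Local Open Scope ereal_scope.
Context d (T : measurableType d) (R : realType).
Variables (mu : {measure set T -> \bar R}) (w : T -> R).
Hypotheses (mw : measurable_fun [set: T] w) (w0 : forall x, (0 <= w x)%R).

(* The proofs are arguments so that the measure instance below is canonical. *)
Definition weighted of measurable_fun [set: T] w & (forall x, (0 <= w x)%R) :=
  fun A : set T => \int[mu]_(x in A) (w x)%:E.

Local Notation nu := (weighted mw w0).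

Let weighted0 : nu set0 = 0.
Proof. exact: integral_set0. Qed.

Let weighted_ge0 A : 0 <= nu A.
Proof. by apply: integral_ge0 => x _; rewrite lee_fin. Qed.

Let weighted_sigma_additive : semi_sigma_additive nu.
Proof.
move=> /= F mF tF mUF; rewrite /weighted; apply: cvg_toP.
  apply: ereal_nondecreasing_is_cvgn => m n mn.
  apply: lee_sum_nneg_natr => // k _ _.
  by apply: integral_ge0 => x _; rewrite lee_fin.
rewrite ge0_integral_bigcup//.
- by apply/measurable_EFinP; exact: measurable_funTS.
- by move=> x _; rewrite lee_fin.
Qed.

HB.instance Definition _ := isMeasure.Build _ _ _ nu
  weighted0 weighted_ge0 weighted_sigma_additive.

Import HBNNSimple.

(** By monotone convergence both sides are limits along simple functions increasing to [f]. For a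
    simple function, split over its level sets: on each one the identity is the definition of
    [weighted]. *)
Lemma ge0_integral_weighted (f : T -> \bar R) : measurable_fun [set: T] f ->
  (forall x, 0 <= f x) -> \int[nu]_x f x = \int[mu]_x (f x * (w x)%:E).
Proof.
move=> mf f0; pose f_ := nnsfun_approx measurableT mf.
have cf x : (f_ n x)%:E @[n --> \oo] --> f x by exact: cvg_nnsfun_approx.
have mfn n : measurable_fun [set: T] (EFin \o f_ n).
  exact/measurable_EFinP/measurable_funP.
have f_nd x : {homo (fun n => (f_ n x)%:E) : m n / (m <= n)%N >-> m <= n}.
  by move=> m n mn; rewrite lee_fin; exact/lefP/nd_nnsfun_approx.
transitivity (limn (fun n => \int[nu]_x (f_ n x)%:E)).
  rewrite -monotone_convergence//.
  - by apply: eq_integral => x _; apply/esym/cvg_lim.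
  - by move=> n x _; rewrite lee_fin.
transitivity (limn (fun n => \int[mu]_x ((f_ n x)%:E * (w x)%:E))); last first.
  rewrite -monotone_convergence//.
  - by apply: eq_integral => x _; apply/cvg_lim => //; exact: cvgeZr.
  - by move=> n; apply: emeasurable_funM => //; exact/measurable_EFinP.
  - by move=> n x _; rewrite mule_ge0// lee_fin.
  - by move=> x _ m n mn; rewrite lee_wpmul2r ?lee_fin// -lee_fin f_nd.
congr (limn _); apply/funext => n.
have mk r : measurable (f_ n @^-1` [set r]) by exact: measurable_funPTI.
transitivity (\sum_(r \in range (f_ n))
    \int[mu]_x (r * \1_(f_ n @^-1` [set r]) x * w x)%:E).
  under eq_integral do rewrite fimfunE -fsumEFin//.
  rewrite ge0_integral_fsum//; last 2 first.
  - by move=> r; exact/measurable_EFinP/measurable_funM.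
  - by move=> r x _; rewrite nnfun_muleindic_ge0.
  apply: eq_fsbigr => r; rewrite inE => -[x _ <-].
  under [RHS]eq_integral do rewrite -mulrA EFinM.
  rewrite integralZl_indic_nnsfun// integral_indic// setIT.
  rewrite ge0_integralZl//=; last 3 first.
  - by apply/measurable_EFinP; exact: measurable_funM.
  - by move=> y _; rewrite lee_fin mulr_ge0.
  - by rewrite lee_fin.
  congr (_ * _); rewrite /weighted integral_mkcond.
  apply: eq_integral => y _; rewrite patchE indicE.
  by case: (y \in _); rewrite ?mul1r ?mul0r.
rewrite -ge0_integral_fsum//.
- apply: eq_integral => x _; rewrite fsumEFin// -EFinM; congr EFin.
  rewrite [in RHS]fimfunE [RHS]mulr_fsuml//.
- by move=> r; apply/measurable_EFinP/measurable_funM => //; exact: measurable_funM.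
- move=> r x _; rewrite EFinM mule_ge0// ?lee_fin//.
  by rewrite -lee_fin nnfun_muleindic_ge0.
Qed.
End weighted_measure.

(** The canonical measure structure on the pushforward is named explicitly, so that the
    measurability proof can be passed by hand and the result used wherever a bundled measure is
    expected. *)
Definition image_measure d1 d2 (T1 : measurableType d1) (T2 : measurableType d2)
    (R : realType) (m : {measure set T1 -> \bar R}) (f : T1 -> T2)
    (mf : measurable_fun setT f) : {measure set T2 -> \bar R} :=
  measure_function_pushforward__canonical__measure_function_Measure m mf.

Lemma ge0_integral_image d1 d2 (T1 : measurableType d1)
    (T2 : measurableType d2) (R : realType) (m : {measure set T1 -> \bar R})
    (f : T1 -> T2) (mf : measurable_fun setT f) (D : set T2)
    (g : T2 -> \bar R) :
  measurable D -> measurable_fun setT g -> (forall y, 0 <= g y)%E ->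
  (\int[image_measure m mf]_(y in D) g y = \int[m]_(x in f @^-1` D) g (f x))%E.
Proof.
by move=> mD mg g0; apply: ge0_integral_pushforward => //; exact: measurable_funTS.
Qed.

(* Multiplying a centered Gaussian density of variance [v] by
   [exp (- s x^2 / v)] shrinks its standard deviation by this factor. *)
Definition shrink {R : realType} (s : R) : R := (1 + 2 * s) `^ (- 2^-1).

Lemma shrink_gt0 {R : realType} (s : R) : 0 <= s -> 0 < shrink s.
Proof. by move=> s0; apply: powR_gt0; rewrite ltr_pwDl// mulr_ge0. Qed.

(** * Dilations of Lebesgue measure and exponential tilting of one Gaussian *)

Section normal_scaling.
Local Open Scope ereal_scope.
Context {R : realType}.
Local Notation mu := (@lebesgue_measure R).

(** Uniqueness of Lebesgue measure: [c] times its image under the dilation by [c] gives each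
    half-open interval its length. *)
Lemma lebesgue_measure_scale (c : R) (A : set R) : (0 < c)%R -> measurable A ->
  mu [set x | A (c * x)%R] = c^-1%:E * mu A.
Proof.
move=> c0 mA.
have mc : measurable_fun [set: measurableTypeR R]
    (fun x : measurableTypeR R => (c * x)%R : measurableTypeR R).
  exact: measurable_funM.
pose nu := mscale (NngNum (ltW c0)) (image_measure mu mc).
have -> : mu A = nu A.
  apply: lebesgue_measure_unique => // _ [[a b]] _ <-.
  rewrite -[RHS]/(c%:E * mu ((fun x => c * x)%R @^-1` `]a, b])).
  rewrite (_ : _ @^-1` _ = `](a / c)%R, (b / c)%R]%classic); last first.
    apply/seteqP; split => x /=; rewrite !in_itv/= ltr_pdivrMr// ler_pdivlMr//;
      by rewrite mulrC.
  rewrite !lebesgue_measure_itv/= !lte_fin ltr_pM2r ?invr_gt0//.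
  case: ifPn => _; last by rewrite mule0.
  by rewrite -EFinB -EFinM -mulrBl mulrC mulfVK ?gt_eqF.
by rewrite muleA -EFinM mulVf ?gt_eqF// mul1e.
Qed.

Lemma ge0_integral_scale (c : R) (B : set R) (f : R -> R) : (0 < c)%R ->
  measurable B -> measurable_fun setT f -> (forall x, 0 <= f x)%R ->
  \int[mu]_(x in [set x | B (c * x)%R]) (f (c * x)%R)%:E =
  c^-1%:E * \int[mu]_(x in B) (f x)%:E.
Proof.
move=> c0 mB mf f0.
have ci0 : (0 <= c^-1)%R by rewrite invr_ge0 ltW.
have mc : measurable_fun [set: measurableTypeR R]
    (fun x : measurableTypeR R => (c * x)%R : measurableTypeR R).
  exact: measurable_funM.
have mfB : measurable_fun B (EFin \o f).
  by apply/measurable_EFinP; exact: measurable_funTS.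
transitivity (\int[image_measure mu mc]_(x in B) (f x)%:E).
  rewrite (ge0_integral_image mu mc (D := B) (g := EFin \o f))//.
  exact/measurable_EFinP.
transitivity (\int[mscale (NngNum ci0) mu]_(x in B) (f x)%:E).
  by apply: eq_measure_integral => A mA _; exact: lebesgue_measure_scale.
by rewrite ge0_integral_mscale// => x _; rewrite lee_fin.
Qed.

(** The exponents add up to [- (1 + 2 * s) * x ^+ 2 / (2 * v)], which is the Gaussian exponent at
    [x / c] for [c = shrink s], because [c ^+ 2 = (1 + 2 * s)^-1]. The change of variable
    [x = c * y] then produces the factor [c]. *)
Lemma normal_prob_scale (v s : R) (B : set R) : (0 < v)%R -> (0 <= s)%R ->
  measurable B ->
  \int[normal_prob 0 (Num.sqrt v)]_(x in B) (expR (- (s * (x ^+ 2 / v))))%:E =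
  (shrink s)%:E *
  normal_prob 0 (Num.sqrt v) [set x | B (shrink s * x)%R].
Proof.
move=> v0 s0 mB; set c := shrink s.
have s1 : (0 < 1 + 2 * s)%R by rewrite ltr_pwDl// mulr_ge0.
have c0 : (0 < c)%R by exact: shrink_gt0.
have sv0 : Num.sqrt v != 0%R by rewrite gt_eqF// sqrtr_gt0.
have cE : (c ^+ 2 = (1 + 2 * s)^-1)%R.
  rewrite -powR_mulrn ?ltW// /c /shrink.
  by rewrite -powRrM mulNr mulVf// powR_inv1// ltW.
pose w x := normal_pdf 0 (Num.sqrt v) x.
have mw : measurable_fun setT w by exact: measurable_normal_pdf.
have w0 x : (0 <= w x)%R by exact: normal_pdf_ge0.
have me : measurable_fun setT (fun x : R => expR (- (s * (x ^+ 2 / v)))).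
  apply: measurableT_comp => //; apply: measurable_funN.
  by apply: measurable_funM => //; apply: measurable_funM => //;
    exact: exprn_measurable.
transitivity (\int[mu]_(x in B) (w (x / c)%R)%:E); last first.
  pose g x := w (x / c)%R.
  have mg : measurable_fun setT g.
    by apply: measurableT_comp => //; exact: measurable_funM.
  have := @ge0_integral_scale c B g c0 mB mg.
  rewrite /g => /(_ (fun x => w0 (x / c)%R)) H.
  rewrite /normal_prob.
  transitivity (c%:E * (c^-1%:E * \int[mu]_(x in B) (w (x / c)%R)%:E)).
    by rewrite muleA -EFinM divff ?gt_eqF// mul1e.
  rewrite -H; congr (_ * _); apply: eq_integral => x _.
  by rewrite mulrAC divff ?gt_eqF// mul1r.
transitivity (\int[weighted mu mw w0]_x
    ((fun x => (expR (- (s * (x ^+ 2 / v))))%:E) \_ B) x).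
  rewrite integral_mkcond; apply: eq_measure_integral => A mA _.
  by rewrite /normal_prob.
rewrite ge0_integral_weighted; last 2 first.
- apply/(measurable_restrictT _ _).1 => //.
  by apply/measurable_EFinP; exact: measurable_funTS.
- by move=> x; rewrite patchE; case: ifPn => // _; rewrite lee_fin expR_ge0.
rewrite [RHS]integral_mkcond; apply: eq_integral => x _.
rewrite !patchE; case: ifPn => _; last by rewrite mul0e.
rewrite -EFinM /w !normal_pdfE// /normal_fun; congr EFin.
rewrite mulrCA -expRD; congr (_ * expR _)%R.
rewrite !subr0 sqr_sqrtr ?ltW// exprMn exprVn cE invrK.
field.
by rewrite gt_eqF.
Qed.

(** This carries the tilting identity to the sample space through the law of [X]. The event sits in
    the integrand as an indicator, so that such integrands can be multiplied over the
    coordinates. *)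
Lemma centered_normal_scale d (T : measurableType d) (P : probability T R)
    (v s : R) (X : T -> R) (B : set R) :
  is_centered_normal P v X -> (0 < v)%R -> (0 <= s)%R -> measurable B ->
  \int[P]_t (\1_B (X t) * expR (- (s * (X t ^+ 2 / v))))%:E =
  (shrink s)%:E *
  P [set t | B (shrink s * X t)%R].
Proof.
move=> [mX XP] v0 s0 mB; set c := shrink s.
have mc : measurable_fun [set: R] (fun x => c * x)%R by exact: measurable_funM.
have -> : P [set t | B (c * X t)%R] =
    normal_prob 0 (Num.sqrt v) [set x | B (c * x)%R].
  by rewrite -XP//; rewrite -[X in measurable X]setTI; exact: mc.
rewrite -normal_prob_scale//.
have me : measurable_fun setT (fun x : R => expR (- (s * (x ^+ 2 / v)))).
  apply: measurableT_comp => //; apply: measurable_funN.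
  by apply: measurable_funM => //; apply: measurable_funM => //;
    exact: exprn_measurable.
have me' : measurable_fun [set: R]
    (fun x : R => (expR (- (s * (x ^+ 2 / v))))%:E).
  exact/measurable_EFinP.
have mX' : measurable_fun setT (X : T -> measurableTypeR R) by exact: mX.
transitivity (\int[image_measure P mX']_(x in B)
    (expR (- (s * (x ^+ 2 / v))))%:E); last first.
  by apply: eq_measure_integral => A mA _; rewrite /= -XP.
rewrite (ge0_integral_image P mX'
    (g := fun x => (expR (- (s * (x ^+ 2 / v))))%:E))//.
rewrite integral_mkcond; apply: eq_integral => t _.
rewrite patchE indicE (_ : (t \in X @^-1` B) = (X t \in B))//.
by case: (_ \in B); rewrite ?mul1r ?mul0r.
Qed.

End normal_scaling.

(** * Product formula for integrals under independence *)

Section independence.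
Local Open Scope ereal_scope.
Context d (T : measurableType d) (R : realType) (P : probability T R).

(** The last hypothesis says that the law of [X] under the measure of density [g] is [K] times its
    law under [P]. Equal measures give [f] equal integrals. *)
Lemma ge0_integral_factor (g : T -> R) (X : T -> R) (K : R) (f : R -> R) :
  measurable_fun setT g -> (forall t, 0 <= g t)%R ->
  measurable_fun setT X -> (0 <= K)%R ->
  measurable_fun setT f -> (forall x, 0 <= f x)%R ->
  (forall B, measurable B ->
    \int[P]_t (\1_B (X t) * g t)%:E = K%:E * P (X @^-1` B)) ->
  \int[P]_t (f (X t) * g t)%:E = K%:E * \int[P]_t (f (X t))%:E.
Proof.
move=> mg g0 mX K0 mf f0 gK.
have mfE : measurable_fun setT (EFin \o f) by exact/measurable_EFinP.
have mfXE : measurable_fun setT (fun t => (f (X t))%:E).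
  exact: (measurableT_comp mfE).
have f0E x : 0 <= (f x)%:E by rewrite lee_fin.
have gXE B : measurable B ->
    image_measure (weighted P mg g0) mX B = K%:E * P (X @^-1` B).
  move=> mB; rewrite -gK// /= /pushforward /weighted integral_mkcond.
  apply: eq_integral => t _; rewrite patchE indicE.
  rewrite (_ : (t \in X @^-1` B) = (X t \in B))//.
  by case: (_ \in B); rewrite ?mul1r ?mul0r.
transitivity (\int[image_measure (weighted P mg g0) mX]_x (f x)%:E).
  rewrite (ge0_integral_image _ mX (g := EFin \o f))//.
  by rewrite ge0_integral_weighted// => t; exact: f0E.
rewrite -(ge0_integral_image P mX (g := EFin \o f) measurableT mfE f0E).
rewrite -(ge0_integral_mscale _ _ (NngNum K0))//; last first.
  by move=> x _; exact: f0E.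
by apply: eq_measure_integral => A mA _; rewrite gXE.
Qed.

Lemma independent_integral_prod (I : finType) (F : I -> T -> R)
    (f : I -> R -> R) :
  mutually_independent P F ->
  (forall i, measurable_fun setT (f i)) ->
  (forall i x, 0 <= f i x <= 1)%R ->
  \int[P]_t (\prod_(i <- enum I) f i (F i t))%:E =
  \prod_(i <- enum I) \int[P]_t (f i (F i t))%:E.
Proof.
move=> [mF PF] mf f01.
have mfF (h : R -> R) i : measurable_fun setT h ->
    measurable_fun setT (fun t => h (F i t)).
  by move=> mh; exact: measurableT_comp.
(* Indicators are replaced by general functions one coordinate at a time. *)
suff H (s : seq I) : uniq s -> forall f : I -> R -> R,
    (forall i, measurable_fun setT (f i)) ->
    (forall i x, 0 <= f i x <= 1)%R ->
    (forall i, i \notin s -> exists2 B, measurable B & f i = \1_B) ->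
  \int[P]_t (\prod_(i <- enum I) f i (F i t))%:E =
  \prod_(i <- enum I) \int[P]_t (f i (F i t))%:E.
  have := H (enum I) (enum_uniq I) f mf f01.
  by apply => i; rewrite mem_enum.
have prodD1 (V : Type) (one : V) (op : Monoid.com_law one) (h : I -> V) j :
    \big[op/one]_(i <- enum I) h i =
    op (h j) (\big[op/one]_(i <- enum I | i != j) h i).
  by rewrite big_enum big_enum_cond (bigD1 j).
(* In the base case every function is an indicator, the product is the indicator of an intersection,
   and the claim is the definition of independence. *)
elim: s {f mf f01} => [_ f mf f01 fB|j s IH /= /andP[js us] f mf f01 fB].
  have /choice[B fE] i : exists B : set R, measurable B /\ f i = \1_B.
    by have [//|B mB ->] := fB i; exists B.
  have mFB i : measurable (F i @^-1` B i).
    by rewrite -[X in measurable X]setTI; apply: mF => //; have [] := fE i.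
  have mcap : measurable (\bigcap_(i in [set: I]) (F i @^-1` B i)).
    by apply: fin_bigcap_measurable => //; exact: finite_finset.
  have indE i t : (f i (F i t) = \1_(F i @^-1` B i) t)%R.
    by have [_ ->] := fE i; rewrite !indicE.
  transitivity (P (\bigcap_(i in [set: I]) (F i @^-1` B i))).
    rewrite -[in RHS](setIT (\bigcap_(i in _) _)) -integral_indic//.
    apply: eq_integral => t _; congr EFin.
    under eq_bigr do rewrite indE.
    rewrite indicE; have [tB|tB] := boolP (t \in _).
      rewrite big1// => i _; rewrite indicE mem_set//.
      by move: tB; rewrite inE => /(_ i); exact.
    have [i ti] : exists i, ~ (F i @^-1` B i) t.
      apply: contrapT => /forallNP tF; move/negP: tB; apply.
      by rewrite inE => i _; apply: contrapT.
    by rewrite (prodD1 _ _ _ _ i)/= indicE memNset// mul0r.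
  rewrite PF; last by move=> i; have [] := fE i.
  apply: eq_bigr => i _; under eq_integral do rewrite indE.
  by rewrite integral_indic// setIT.
have fint i : 0 <= \int[P]_t (f i (F i t))%:E <= 1.
  rewrite integral_ge0/=; last first.
    by move=> t _; rewrite lee_fin; case/andP: (f01 i (F i t)).
  apply: (@le_trans _ _ (\int[P]_t (1%:E))); last first.
    by rewrite integral_cst// mul1e probability_le1.
  apply: ge0_le_integral => //.
  - by move=> t _; rewrite lee_fin; case/andP: (f01 i (F i t)).
  - by apply/measurable_EFinP; exact: mfF.
  - by move=> t _; rewrite lee_fin; case/andP: (f01 i (F i t)).
(* The bounds by 1 make the product of the other integrals finite, hence usable as the real constant
   of [ge0_integral_factor]. *)
pose K := \prod_(i <- enum I | i != j) \int[P]_t (f i (F i t))%:E.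
have K01 : 0 <= K <= 1.
  rewrite /K; elim/big_rec : _ => [|i x _ /andP[x0 x1]].
    by rewrite lee01 lexx.
  have /andP[i0 i1] := fint i.
  by rewrite mule_ge0//= -[leRHS]mule1 lee_pmul.
have Kfin : K \is a fin_num.
  by case/andP: K01 => K0 K1; rewrite ge0_fin_numE// (le_lt_trans K1)// ltry.
rewrite (prodD1 _ _ _ _ j)/= -/K muleC -[K]fineK//.
pose g t := (\prod_(i <- enum I | i != j) f i (F i t))%R.
under eq_integral do rewrite (prodD1 _ _ _ _ j)/= -/(g _).
apply: ge0_integral_factor => //.
- rewrite /g; under eq_fun do rewrite big_mkcond.
  apply: measurable_prod => i _; case: (i != j) => //.
  exact: mfF.
- by move=> t; apply: prodr_ge0 => i _; case/andP: (f01 i (F i t)).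
- by rewrite fine_ge0//; case/andP: K01.
- by move=> x; case/andP: (f01 j x).
move=> B mB.
(* With coordinate [j] turned into an indicator, every function outside [s] is one, so the induction
   hypothesis supplies the identity on indicators that [ge0_integral_factor] asks for. *)
pose f' i := if i == j then \1_B else f i.
have f'j : f' j = \1_B by rewrite /f' eqxx.
have f'i i : i != j -> f' i = f i by rewrite /f' => /negPf ->.
have := IH us f'; rewrite !(prodD1 _ _ _ _ j)/= f'j.
rewrite (eq_bigr (fun i => \int[P]_t (f i (F i t))%:E)); last first.
  by move=> i ij; rewrite f'i.
rewrite -/K; under eq_integral.
  move=> t _; rewrite (prodD1 _ _ _ _ j)/= f'j (eq_bigr (fun i => f i (F i t))); last first.
    by move=> i ij; rewrite f'i.
  rewrite -/(g t); over.
have -> : \int[P]_t (\1_B (F j t))%:E = P (F j @^-1` B).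
  rewrite -[in RHS](setIT (F j @^-1` B)) -integral_indic//.
  by rewrite -[X in measurable X]setTI; exact: mF.
rewrite fineK// muleC; apply.
- move=> i; rewrite /f'; case: ifPn => // _.
- move=> i x; rewrite /f'; case: ifPn => // _.
  by rewrite indicE; case: (_ \in _); rewrite ?lexx ?ler01.
- move=> i; rewrite /f'; case: ifPn => [_ _|ij iS]; first by exists B.
  by apply: fB; rewrite inE negb_or ij.
Qed.

End independence.

(** * The product sigma-algebra on finite real vectors *)

Section boxes.
Context (I : finType) (R : realType).

(** Measurable rectangles. They are closed under intersection and, [I] being finite, generate the
    product sigma-algebra. *)
Definition boxes : set (set (I -> R)) :=
  [set A | exists2 B : I -> set R, forall i, measurable (B i) &
    A = \bigcap_(i in [set: I]) [set x | B i (x i)]].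

Definition vec := g_sigma_algebraType boxes.

Lemma measurable_coord (i : I) : measurable_fun [set: vec] (fun x : vec => x i).
Proof.
move=> _ B mB; rewrite setTI; apply: sub_sigma_algebra.
exists (fun j => if j == i then B else setT) => [j|].
  by case: ifP.
apply/seteqP; split => [x xB j _ /=|x /(_ i Logic.I)/=]; last by rewrite eqxx.
by case: eqVneq => // ->.
Qed.

Lemma measurable_to_vec d (T : measurableType d) (F : I -> T -> R) :
  (forall i, measurable_fun setT (F i)) ->
  measurable_fun setT (fun t => (fun i => F i t) : vec).
Proof.
move=> mF; apply: (@measurability _ _ T vec setT _ boxes) => // _ [_ [B mB ->] <-].
rewrite setTI preimage_bigcap; apply: fin_bigcap_measurable => // i _.
by rewrite -[X in measurable X]setTI; exact: mF.
Qed.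

(** Boxes form a pi-system containing the whole space, so with finite total mass the constant
    sequence [setT] serves as the exhaustion in the uniqueness theorem for measures. *)
Lemma boxes_measure_unique (m1 m2 : {measure set vec -> \bar R}) :
  (forall B : I -> set R, (forall i, measurable (B i)) ->
    m1 (\bigcap_(i in [set: I]) [set x : vec | B i (x i)]) =
    m2 (\bigcap_(i in [set: I]) [set x : vec | B i (x i)])) ->
  (m1 setT < +oo)%E -> forall A, measurable A -> m1 A = m2 A.
Proof.
move=> m12 m1oo A mA.
have boxT : boxes setT.
  exists (fun=> setT) => //.
  by apply/seteqP; split.
apply: (@measure_unique _ R vec boxes (fun=> setT) _ _ _ _ m1 m2) => //.
- move=> _ _ [B mB ->] [C mC ->]; exists (fun i => B i `&` C i).
    by move=> i; exact: measurableI.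
  by rewrite -bigcapI.
- by rewrite bigcup_const.
- by move=> _ [B mB ->]; exact: m12.
Qed.

End boxes.

(** * Exponential tilting of an independent Gaussian vector *)

Section gaussian_vector.
Local Open Scope ereal_scope.
Context d (T : measurableType d) (R : realType) (P : probability T R).
Context (I : finType) (F : I -> T -> R) (v : I -> R).
Hypotheses (indep : mutually_independent P F).
Hypotheses (normalF : forall i, is_centered_normal P (v i) (F i)).
Hypotheses (v0 : forall i, (0 < v i)%R).

(** The squared radius after standardizing each coordinate by its variance [v i]; on the Gaussian
    vector it is chi-squared with [#|I|] degrees of freedom. *)
Definition sumsq (x : vec I R) : R := (\sum_i x i ^+ 2 / v i)%R.

Lemma sumsq_ge0 x : (0 <= sumsq x)%R.
Proof.
by apply: sumr_ge0 => i _; rewrite divr_ge0 ?sqr_ge0// ltW.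
Qed.

Lemma measurable_sumsq : measurable_fun setT sumsq.
Proof.
apply: measurable_sum => i; apply: measurable_funM => //.
by apply: measurable_funX; exact: measurable_coord.
Qed.

Let mF i : measurable_fun setT (F i).
Proof. by case: (normalF i). Qed.

Let V t : vec I R := fun i => F i t.

Let mV : measurable_fun setT V.
Proof. exact: measurable_to_vec. Qed.

Let mexp (s : R) : measurable_fun setT (fun t => expR (- (s * sumsq (V t)))).
Proof.
apply: measurableT_comp => //; apply: measurable_funN.
apply: measurable_funM => //.
by apply: measurableT_comp => //; exact: measurable_sumsq.
Qed.

(** Two laws on [vec] are compared: that of [V] weighted by the exponential, and [c ^+ #|I|] times
    that of [c V], with [c = shrink s]. On boxes the exponential of [sumsq] splits over coordinates,
    independence factors the integral, and each factor is a one-dimensional tilt.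
    [boxes_measure_unique] does the rest. *)
Lemma integral_gaussian_weight (s : R) (G : vec I R -> R) : (0 <= s)%R ->
  measurable_fun setT G -> (forall x, 0 <= G x)%R ->
  \int[P]_t (G (V t) * expR (- (s * sumsq (V t))))%:E =
  (shrink s ^+ #|I|)%:E * \int[P]_t (G (fun i => (shrink s * F i t)%R))%:E.
Proof.
move=> s0 mG G0; set c := shrink s.
have c0 : (0 < c)%R by exact: shrink_gt0.
have cN0 : (0 <= c ^+ #|I|)%R by rewrite exprn_ge0 ?ltW.
pose W t : vec I R := fun i => (c * F i t)%R.
have mW : measurable_fun setT W.
  by apply: measurable_to_vec => i; exact: measurable_funM.
have e0 t : (0 <= expR (- (s * sumsq (V t))))%R by exact: expR_ge0.
pose m1 := image_measure (weighted P (mexp s) e0) mV.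
pose m2 := mscale (NngNum cN0) (image_measure P mW).
have mGE : measurable_fun setT (EFin \o G) by exact/measurable_EFinP.
have G0E x : 0 <= (EFin \o G) x by rewrite lee_fin.
transitivity (\int[m1]_x (EFin \o G) x).
  rewrite ge0_integral_image// ge0_integral_weighted//.
  exact: (measurableT_comp mGE).
rewrite -[X in _ * X]/(\int[P]_(t in W @^-1` setT) (EFin \o G) (W t)).
rewrite -(ge0_integral_image P mW)// -(ge0_integral_mscale _ _ (NngNum cN0))//.
apply: eq_measure_integral => A mA _; apply: boxes_measure_unique => //=.
  move=> B mB; rewrite /pushforward/= /weighted.
  pose f i x : R := (\1_(B i) x * expR (- (s * (x ^+ 2 / v i))))%R.
  transitivity (\int[P]_t (\prod_(i <- enum I) f i (F i t))%:E).
    rewrite integral_mkcond; apply: eq_integral => t _; rewrite patchE big_enum/=.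
    have [|tB] := boolP (t \in _).
      rewrite inE => tB; congr EFin; rewrite /sumsq mulr_sumr -sumrN expR_sum.
      by apply: eq_bigr => i _; rewrite /f indicE mem_set ?mul1r//; exact: tB.
    have [i ti] : exists i, ~ B i (F i t).
      apply: contrapT => /forallNP tF; move/negP: tB; apply.
      by rewrite inE => i _; apply: contrapT; exact: tF.
    by rewrite (bigD1 i)//= /f indicE memNset// !mul0r.
  rewrite independent_integral_prod//; last 2 first.
  - move=> i; apply: measurable_funM => //; apply: measurableT_comp => //.
    apply: measurable_funN; apply: measurable_funM => //.
    by apply: measurable_funM => //; exact: measurable_funX.
  - move=> i x; rewrite mulr_ge0 ?expR_ge0//= mulr_ile1 ?expR_ge0//.
    by rewrite -expR0 ler_expR oppr_le0 mulr_ge0// divr_ge0 ?sqr_ge0// ltW.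
  under eq_bigr do rewrite centered_normal_scale//.
  rewrite big_split/= big_enum/= prodEFin prodr_const; congr (_ * _).
  case: indep => _ /(_ (fun i => [set x | B i (c * x)%R])) <-.
    by congr (P _); rewrite preimage_bigcap.
  move=> i; rewrite -[X in measurable X]setTI.
  have : measurable_fun [set: R] (fun x => c * x)%R by exact: measurable_funM.
  exact.
rewrite /pushforward/= /weighted preimage_setT.
apply: (@le_lt_trans _ _ (\int[P]_t 1%:E)); last first.
  by rewrite integral_cst// mul1e (le_lt_trans (probability_le1 _ _))// ltry.
apply: ge0_le_integral => //.
- by apply/measurable_EFinP; exact: mexp.
- by move=> t _; rewrite lee_fin -expR0 ler_expR oppr_le0 mulr_ge0// sumsq_ge0.
Qed.

End gaussian_vector.

(** * Tail integrals of exponentials and of powers of [shrink] *)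

Section laplace_calculus.
Context {R : realType}.
Local Notation mu := (@lebesgue_measure R).

Lemma ge0_integral_antiderivative (f F : R -> R) (a l : R) :
  (forall x, a <= x -> 0 <= f x) ->
  (forall x, a <= x -> {for x, continuous f}) ->
  (forall x, a <= x -> is_derive x 1 F (f x)) ->
  F x @[x --> +oo] --> l ->
  (\int[mu]_(x in `[a, +oo[) (f x)%:E = l%:E - (F a)%:E)%E.
Proof.
move=> f0 cf dF Fl; apply: ge0_continuous_FTC2y => //.
- apply/continuous_within_itvcyP; split.
    by move=> x; rewrite in_itv/= andbT => /ltW; exact: cf.
  by apply: cvg_at_right_filter; exact: cf.
- by move=> x /ltW ax; have [] := dF x ax.
- apply: cvg_at_right_filter; apply: differentiable_continuous.
  by apply/derivable1_diffP; have [] := dF a (lexx _).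
- by move=> x; rewrite in_itv/= andbT => /ltW ax; rewrite derive1E; have [] := dF x ax.
Qed.

Lemma integral_expR_tail (s S : R) : 0 < S ->
  (\int[mu]_(x in `[s, +oo[) (expR (- (x * S)))%:E = (expR (- (s * S)) / S)%:E)%E.
Proof.
move=> S0; pose F x := - S^-1 * expR (- (x * S)).
transitivity (0%:E - (F s)%:E)%E; last first.
  by rewrite sub0e -EFinN /F mulNr opprK mulrC.
apply: ge0_integral_antiderivative.
- by move=> x _; exact: expR_ge0.
- move=> x _; apply: differentiable_continuous; apply/derivable1_diffP.
  exact: ex_derive.
- move=> x _; rewrite /F; apply: is_derive_eq.
  rewrite /GRing.scale/=; field.
  by rewrite gt_eqF.
- rewrite -[X in _ --> X](mulr0 (- S^-1)); apply: cvgMr.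
  apply: (@cvg_comp _ _ _ (fun x => x * S) (fun z => expR (- z)) _
    (pinfty_nbhs R)); last exact: cvgr_expR.
  by apply: gt0_cvgMly.
Qed.

Lemma shrink_sqrt (s : R) : 0 <= s -> shrink s = (Num.sqrt (1 + 2 * s))^-1.
Proof.
by move=> s0; rewrite /shrink powRN powR12_sqrt// ltW// ltr_pwDl// mulr_ge0.
Qed.

Lemma is_derive_shrink (s : R) : 0 <= s -> is_derive s 1 shrink (- shrink s ^+ 3).
Proof.
move=> s0; have s1 : 0 < 1 + 2 * s by rewrite ltr_pwDl// mulr_ge0.
have d1 := is_derive1_powR (- 2^-1) s1.
have d2 : is_derive s 1 (fun x : R => 1 + 2 * x) 2.
  by apply: is_derive_eq; rewrite /GRing.scale/=; ring.
have := @is_derive1_comp R (fun x => x `^ (- 2^-1)) (fun x => 1 + 2 * x) s _ _ d1 d2.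
move=> d; apply: (is_derive_eq d).
rewrite -powR_mulrn ?ltW ?shrink_gt0// /shrink -powRrM.
rewrite (_ : - 2^-1 - 1 = - 2^-1 * 3%:R); last by field.
by field.
Qed.

Lemma is_derive_shrinkX (n : nat) (s : R) : 0 <= s ->
  is_derive s 1 (fun x => shrink x ^+ n.+1) (- n.+1%:R * shrink s ^+ n.+3).
Proof.
move=> s0; have ds := is_derive_shrink s0.
rewrite (_ : (fun x => _) = (shrink : R -> R) ^+ n.+1); last first.
  by apply/funext => x; rewrite exprfctE.
apply: (is_derive_eq (is_deriveX n.+1 ds)).
by rewrite /GRing.scale/= !exprS expr0; ring.
Qed.

Lemma shrink_cvg0 : shrink x @[x --> +oo] --> (0 : R).
Proof.
apply: (@cvg_trans _ ((Num.sqrt (1 + 2 * x))^-1 @[x --> +oo])).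
  by apply: near_eq_cvg; near=> x; rewrite shrink_sqrt.
apply/gtr0_cvgV0.
  by near=> x; rewrite sqrtr_gt0 ltr_pwDl// mulr_ge0.
apply/cvgryPge => A; near=> x.
have [A0|A0] := leP A 0; first by rewrite (le_trans A0)// sqrtr_ge0.
rewrite -(ger0_norm (ltW A0)) -sqrtr_sqr ler_wsqrtr//.
have Ax : A ^+ 2 <= x by near: x; apply: nbhs_pinfty_ge; rewrite num_real.
by have := sqr_ge0 A; lra.
Unshelve. all: by end_near. Qed.

(** Differentiation raises the power of [shrink] by two, so [- shrink x ^+ n / n] is an
    antiderivative; it vanishes at infinity because [n] is positive. Each use yields one factor of
    the final constant. *)
Lemma integral_shrink_tail (s : R) (n : nat) : 0 <= s -> (0 < n)%N ->
  (\int[mu]_(x in `[s, +oo[) (shrink x ^+ n.+2)%:E = (shrink s ^+ n / n%:R)%:E)%E.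
Proof.
move=> s0 n0; pose F (x : R) : R := - n%:R^-1 * shrink x ^+ n.
have n0R : n%:R != 0 :> R by rewrite pnatr_eq0 -lt0n.
transitivity (0%:E - (F s)%:E)%E; last first.
  by rewrite sub0e -EFinN /F mulNr opprK mulrC.
apply: ge0_integral_antiderivative.
- by move=> x sx; rewrite exprn_ge0// ltW// shrink_gt0// (le_trans s0).
- move=> x sx; have dx := is_derive_shrinkX n.+1 (le_trans s0 sx).
  apply: differentiable_continuous; apply/derivable1_diffP.
  exact: (@ex_derive _ _ _ _ _ _ _ dx).
- move=> x sx; have := is_derive_shrinkX n.-1 (le_trans s0 sx).
  rewrite prednK// => dx; rewrite /F.
  apply: (is_derive_eq (is_deriveZ (- n%:R^-1) dx)).
  by rewrite /GRing.scale/= mulrA mulrNN mulVf// mul1r.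
- rewrite -[X in _ --> X](mulr0 (- n%:R^-1)); apply: cvgMr.
  have E : 0 = (0 : R) ^+ n by rewrite expr0n (gtn_eqF n0).
  rewrite [X in _ --> X]E.
  apply: (@cvg_comp _ _ _ shrink (fun y : R => y ^+ n) _ _ _ shrink_cvg0).
  exact: exprn_continuous.
Qed.

End laplace_calculus.

(** * Inverse moments of the squared radius *)

Section inverse_moments.
Local Open Scope ereal_scope.
Context d (T : measurableType d) (R : realType) (P : probability T R).
Local Notation mu := (@lebesgue_measure R).

(* Tonelli applied to [e^(-sS)/S = \int_s^oo e^(-xS) dx]; where [S] vanishes
   the junk value [A / 0 = 0] agrees with the assumption [A = 0]. *)
Lemma integral_laplace_step (A S : T -> R) (s : R) :
  measurable_fun setT A -> measurable_fun setT S ->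
  (forall t, 0 <= A t)%R -> (forall t, 0 <= S t)%R ->
  (forall t, S t = 0 -> A t = 0)%R ->
  \int[P]_t (A t / S t * expR (- (s * S t)))%:E =
  \int[mu]_(x in `[s, +oo[) \int[P]_t (A t * expR (- (x * S t)))%:E.
Proof.
move=> mA mS A0 S0 AS0.
pose f (z : T * measurableTypeR R) : \bar R :=
  (A z.1 * expR (- (z.2 * S z.1)) * \1_(`[s, +oo[%classic : set R) z.2)%:E.
have f0 z : 0 <= f z.
  by rewrite lee_fin !mulr_ge0// expR_ge0.
have mf : measurable_fun setT f.
  apply/measurable_EFinP; apply: measurable_funM; last first.
    exact: (measurableT_comp (measurable_indic _)).
  apply: measurable_funM; first exact: measurableT_comp.
  apply: measurableT_comp => //; apply: measurable_funN.
  by apply: measurable_funM => //; exact: measurableT_comp.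
transitivity (\int[P]_t \int[mu]_x f (t, x)).
  apply: eq_integral => t _.
  transitivity (\int[mu]_(x in `[s, +oo[) (A t * expR (- (x * S t)))%:E); last first.
    rewrite integral_mkcond; apply: eq_integral => x _; rewrite patchE /f indicE/=.
    by case: (_ \in _); rewrite ?mulr1 ?mulr0.
  have [St0|St0] := eqVneq (S t) 0%R.
    rewrite (AS0 _ St0) !mul0r integral0_eq// => x _.
    by rewrite mul0r.
  under eq_integral do rewrite EFinM.
  rewrite ge0_integralZl//; last 2 first.
  - have me : measurable_fun [set: R] (fun x : R => (expR (- (x * S t)))%:E).
      apply/measurable_EFinP; apply: measurableT_comp => //.
      by apply: measurable_funN; exact: measurable_funM.
    exact: (measurable_funTS me).
  - by rewrite lee_fin.
  rewrite integral_expR_tail; last by rewrite lt_neqAle eq_sym St0/=.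
  by rewrite -EFinM mulrA mulrAC.
rewrite (fubini_tonelli _ mf f0).
rewrite [RHS]integral_mkcond; apply: eq_integral => x _; rewrite patchE.
case: ifPn => xs.
  by apply: eq_integral => t _; rewrite /f indicE xs mulr1.
by rewrite integral0_eq// => t _; rewrite /f indicE (negbTE xs) mulr0.
Qed.

Context (I : finType) (F : I -> T -> R) (v : I -> R).
Hypotheses (indep : mutually_independent P F).
Hypotheses (normalF : forall i, is_centered_normal P (v i) (F i)).
Hypotheses (v0 : forall i, (0 < v i)%R).

Let V t : vec I R := fun i => F i t.

Let mV : measurable_fun setT V.
Proof. by apply: measurable_to_vec => i; case: (normalF i). Qed.

Let S t := sumsq v (V t).

Let mS : measurable_fun setT S.
Proof. by apply: measurableT_comp => //; exact: measurable_sumsq. Qed.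

Let S0 t : (0 <= S t)%R.
Proof. exact: sumsq_ge0. Qed.

(** Induction on [j], with [s] free because the next step integrates over it. At [j = 0] the tilt
    gives [shrink s ^+ #|I|] and homogeneity gives [shrink s ^+ (2 * p)]. Each tail integration adds
    a factor [1 / S] on the left; on the right it lowers the exponent by two and divides by the new
    exponent. *)
Lemma integral_inverse_moment_laplace (H : vec I R -> R) (p : nat) :
  (0 < #|I|)%N -> (0 < p)%N ->
  measurable_fun setT H -> (forall x, 0 <= H x)%R ->
  (forall (c : R) x, (0 <= c)%R -> H (fun i => c * x i)%R = c ^+ (2 * p) * H x)%R ->
  forall (j : nat) (s : R), (j <= p)%N -> (0 <= s)%R ->
  \int[P]_t (H (V t) / S t ^+ j * expR (- (s * S t)))%:E =
  (shrink s ^+ (#|I| + 2 * (p - j)) *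
    \prod_(i < j) (#|I| + 2 * (p - i.+1))%:R^-1)%:E * \int[P]_t (H (V t))%:E.
Proof.
move=> I0 p0 mH H0 Hhom.
have mHV : measurable_fun setT (fun t => (H (V t))%:E).
  by apply/measurable_EFinP; exact: (measurableT_comp mH mV).
elim=> [|j IH] s jp s0.
  rewrite subn0 big_ord0 mulr1.
  under eq_integral do rewrite expr0 divr1.
  rewrite (integral_gaussian_weight indep normalF v0 s0 mH H0).
  under eq_integral do rewrite Hhom ?ltW ?shrink_gt0// EFinM.
  rewrite ge0_integralZl//; last 2 first.
  - by move=> t _; rewrite lee_fin.
  - by rewrite lee_fin exprn_ge0// ltW// shrink_gt0.
  by rewrite muleA -EFinM exprD.
(* A zero radius forces all coordinates to vanish, so [V t] is 0 times itself; homogeneity with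
   [c = 0] and [p > 0] then gives [H (V t) = 0]. *)
have HS t : S t = 0%R -> H (V t) = 0%R.
  move=> St; have Vt0 : V t = (fun i => 0 * V t i)%R.
    apply/funext => i; rewrite mul0r; apply/eqP.
    have /eqP : (F i t ^+ 2 / v i)%R = 0%R.
      by apply: (psumr_eq0P _ St) => // k _; rewrite divr_ge0 ?sqr_ge0// ltW.
    by rewrite mulf_eq0 invr_eq0 (gt_eqF (v0 i)) orbF sqrf_eq0.
  by rewrite Vt0 Hhom// expr0n muln_eq0/= (gtn_eqF p0) mul0r.
transitivity (\int[P]_t (H (V t) / S t ^+ j / S t * expR (- (s * S t)))%:E).
  apply: eq_integral => t _; congr EFin; congr (_ * _)%R.
  by rewrite exprSr invfM mulrA.
rewrite integral_laplace_step//; last 3 first.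
- apply: measurable_funM; first exact/measurable_EFinP.
  (* The inverse becomes [powR] with exponent -1, which is measurable on the whole line; the two
     agree at every nonnegative base, 0 included. *)
  under eq_fun do rewrite -powR_inv1 ?exprn_ge0//.
  have mSj : measurable_fun setT (fun t => S t ^+ j)%R by exact: measurable_funX.
  exact: (measurableT_comp (measurable_powR (-1)%R) mSj).
- by move=> t; rewrite divr_ge0// exprn_ge0.
- by move=> t /HS ->; rewrite mul0r.
set E := \int[P]_t (H (V t))%:E; pose K : R := (\prod_(i < j) (#|I| + 2 * (p - i.+1))%:R^-1)%R.
transitivity (\int[mu]_(x in `[s, +oo[)
    ((shrink x ^+ (#|I| + 2 * (p - j.+1)).+2)%:E * (K%:E * E))).
  apply: eq_integral => x; rewrite inE/= in_itv/= andbT => sx.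
  rewrite IH ?(ltnW jp) ?(le_trans s0)// -/K EFinM -muleA.
  rewrite (_ : (_ + _)%N = (#|I| + 2 * (p - j.+1)).+2)//.
  by rewrite -(subnSK jp) mulnS addnCA addnA add2n.
rewrite ge0_integralZr//; last 3 first.
- have msh : measurable_fun setT
      (fun x : R => (shrink x ^+ (#|I| + 2 * (p - j.+1)).+2)%:E).
    apply/measurable_EFinP; apply: measurable_funX.
    apply: (measurableT_comp (measurable_powR _)) => //.
    by apply: measurable_funD => //; exact: measurable_funM.
  exact: (measurable_funTS msh).
- move=> x; rewrite /= in_itv/= andbT => sx.
  by rewrite lee_fin exprn_ge0// ltW// shrink_gt0// (le_trans s0).
- rewrite mule_ge0//; last by apply: integral_ge0 => t _; rewrite lee_fin.
  by rewrite lee_fin prodr_ge0// => i _; rewrite invr_ge0.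
(* When [j.+1 = p] the remaining exponent is just [#|I|], so its positivity must come from [I0]. *)
rewrite integral_shrink_tail//; last by rewrite addn_gt0 I0.
rewrite big_ord_recr/= muleA -EFinM; congr (_%:E * _).
by rewrite -/K mulrAC mulrA.
Qed.

(** Take [j = p] and [s = 0] in the Laplace identity, where the exponential and [shrink] are both 1.
    The case [p = 0] is separate, as homogeneity of degree 0 does not make [H] vanish at the
    origin. *)
Lemma ge0_integral_inverse_moment (H : vec I R -> R) (p : nat) :
  (0 < #|I|)%N -> measurable_fun setT H -> (forall x, 0 <= H x)%R ->
  (forall (c : R) x, (0 <= c)%R -> H (fun i => c * x i)%R = c ^+ (2 * p) * H x)%R ->
  \int[P]_t (H (V t) / S t ^+ p)%:E =
  (\prod_(i < p) (#|I| + 2 * i)%:R^-1)%:E * \int[P]_t (H (V t))%:E.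
Proof.
move=> I0 mH H0 Hhom; have [p0|p0] := posnP p.
  rewrite p0 big_ord0 mul1e; apply: eq_integral => t _.
  by rewrite expr0 divr1.
have := integral_inverse_moment_laplace I0 p0 mH H0 Hhom (leqnn p) (lexx 0%R).
under eq_integral do rewrite mul0r oppr0 expR0 mulr1.
move=> ->; rewrite /shrink mulr0 addr0 powR1 expr1n mul1r; congr (_%:E * _).
by rewrite [RHS](reindex_inj rev_ord_inj).
Qed.

(** The nonnegative case applies to the positive and negative parts of [h], which stay homogeneous
    because [c ^+ (2 * p)] is nonnegative. The constant [k] in the integrand makes room for the
    normalization of [Chat]. *)
Lemma integral_inverse_moment (h : vec I R -> R) (p : nat) (k : R) :
  (0 < #|I|)%N -> (0 < k)%R -> measurable_fun setT h ->
  (forall (c : R) x, (0 <= c)%R -> h (fun i => c * x i)%R = c ^+ (2 * p) * h x)%R ->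
  \int[P]_t (k * (h (V t) / S t ^+ p))%:E =
  (k * \prod_(i < p) (#|I| + 2 * i)%:R^-1)%:E * \int[P]_t (h (V t))%:E.
Proof.
move=> I0 k0 mh hhom; set K : R := (k * _)%R.
have K0 : (0 < K)%R.
  rewrite mulr_gt0// prodr_gt0// => i _.
  by rewrite invr_gt0 ltr0n addn_gt0 I0.
have maxE (g : vec I R -> R) : measurable_fun setT g ->
    (forall (c : R) x, (0 <= c)%R -> g (fun i => c * x i)%R = c ^+ (2 * p) * g x)%R ->
    \int[P]_t maxe (k * (g (V t) / S t ^+ p))%:E 0 =
    K%:E * \int[P]_t maxe (g (V t))%:E 0.
  move=> mg ghom; pose H x := (k * Num.max (g x) 0)%R.
  have mH : measurable_fun setT (fun x => Num.max (g x) 0)%R.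
    exact: measurable_maxr.
  transitivity (\int[P]_t (H (V t) / S t ^+ p)%:E).
    apply: eq_integral => t _; rewrite -EFin_max; congr EFin.
    rewrite /H -mulrA -[in LHS](mulr0 k) -maxr_pMr ?(ltW k0)//; congr (_ * _)%R.
    by rewrite maxr_pMl ?invr_ge0 ?exprn_ge0// mul0r.
  rewrite ge0_integral_inverse_moment//; last 3 first.
  - exact: measurable_funM.
  - by move=> x; rewrite mulr_ge0 ?(ltW k0)// le_max lexx orbT.
  - move=> c x c0; rewrite /H ghom// mulrCA; congr (_ * _)%R.
    by rewrite maxr_pMr ?exprn_ge0// mulr0.
  rewrite /K mulrC EFinM -muleA; congr (_ * _).
  under eq_integral do rewrite EFinM.
  rewrite ge0_integralZl//; last 3 first.
  - by apply/measurable_EFinP; exact: (measurableT_comp mH mV).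
  - by move=> t _; rewrite lee_fin le_max lexx orbT.
  - by rewrite lee_fin ltW.
  by congr (_ * _); apply: eq_integral => t _; rewrite EFin_max.
have -> : \int[P]_t (k * (h (V t) / S t ^+ p))%:E =
    \int[P]_t maxe (k * (h (V t) / S t ^+ p))%:E 0 -
    \int[P]_t maxe (k * (- h (V t) / S t ^+ p))%:E 0.
  rewrite integralE; congr (_ - _); apply: eq_integral => t _.
    by rewrite funeposE.
  by rewrite funenegE mulNr mulrN EFinN.
rewrite maxE// (maxE (fun x => - h x)%R)//; last 2 first.
- exact: measurable_funN.
- by move=> c x c0; rewrite hhom// mulrN.
have -> : \int[P]_t (h (V t))%:E =
    \int[P]_t maxe (h (V t))%:E 0 - \int[P]_t maxe (- h (V t))%:E 0.
  rewrite integralE; congr (_ - _); apply: eq_integral => t _.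
    by rewrite funeposE.
  by rewrite funenegE EFinN.
have : 0 <= \int[P]_t maxe (h (V t))%:E 0.
  by apply: integral_ge0 => t _; rewrite le_max lexx orbT.
have : 0 <= \int[P]_t maxe (- h (V t))%:E 0.
  by apply: integral_ge0 => t _; rewrite le_max lexx orbT.
(* A positive real [K] distributes over the difference in all four cases, including two infinite
   parts, where the difference is [-oo] by convention on both sides. *)
move: (\int[P]_t maxe (h (V t))%:E 0) (\int[P]_t maxe (- h (V t))%:E 0).
move=> [a| |] [b| |]// _ _.
- exact: (congr1 EFin (esym (mulrBr K a b))).
- by rewrite -[X in _ = _ * X]/(-oo) gt0_muley ?lte_fin// gt0_muleNy ?lte_fin.
- by rewrite -[X in _ = _ * X]/(+oo) gt0_muley ?lte_fin.
- by rewrite -[X in _ = _ * X]/(-oo) gt0_muley ?lte_fin// gt0_muleNy ?lte_fin.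
Qed.

End inverse_moments.

(** * Complex monomials: measurability, homogeneity, and the total power *)

Section complex_moments.
Local Open Scope complex_scope.

Definition complex_measurable d (T : measurableType d) (R : realType)
    (f : T -> R[i]) : Prop :=
  measurable_fun setT (fun t => complex.Re (f t)) /\
  measurable_fun setT (fun t => complex.Im (f t)).

Section closure.
Context d (T : measurableType d) (R : realType).
Implicit Types f g : T -> R[i].

Lemma complex_measurableM f g : complex_measurable f -> complex_measurable g ->
  complex_measurable (fun t => f t * g t).
Proof.
move=> [mRf mIf] [mRg mIg]; split.
- rewrite (_ : (fun t => _) = (fun t => complex.Re (f t) * complex.Re (g t) -
    complex.Im (f t) * complex.Im (g t))).
    by apply: measurable_funB; exact: measurable_funM.
  by apply/funext => t; case: (f t) => a b; case: (g t).
- rewrite (_ : (fun t => _) = (fun t => complex.Re (f t) * complex.Im (g t) +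
    complex.Im (f t) * complex.Re (g t))).
    by apply: measurable_funD; exact: measurable_funM.
  by apply/funext => t; case: (f t) => a b; case: (g t).
Qed.

Lemma complex_measurable1 : complex_measurable (fun _ : T => 1 : R[i]).
Proof. by split; exact: measurable_cst. Qed.

Lemma complex_measurableX f n : complex_measurable f ->
  complex_measurable (fun t => f t ^+ n).
Proof.
move=> mf; elim: n => [|n IH]; first exact: complex_measurable1.
by under eq_fun do rewrite exprS; exact: complex_measurableM.
Qed.

Lemma complex_measurable_conj f : complex_measurable f ->
  complex_measurable (fun t => Num.conj (f t)).
Proof.
move=> [mR mI]; split.
  by rewrite (_ : (fun t => _) = (fun t => complex.Re (f t)))//;
    apply/funext => t; case: (f t).
rewrite (_ : (fun t => _) = (fun t => - complex.Im (f t))).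
  exact: measurable_funN.
by apply/funext => t; case: (f t).
Qed.

Lemma complex_measurable_prod (I : Type) (s : seq I) (f : I -> T -> R[i]) :
  (forall i, complex_measurable (f i)) ->
  complex_measurable (fun t => \prod_(i <- s) f i t).
Proof.
move=> mf; elim: s => [|i s IH].
  by under eq_fun do rewrite big_nil; exact: complex_measurable1.
by under eq_fun do rewrite big_cons; exact: complex_measurableM.
Qed.

Lemma complex_measurable_moment_prod k (u : nat -> T -> R[i]) q0
    (m q q' : 'I_k -> nat) :
  (forall j, complex_measurable (u j)) ->
  complex_measurable (moment_prod u q0 m q q').
Proof.
move=> mu; apply: complex_measurableM; first exact: complex_measurableX.
apply: complex_measurable_prod => i; apply: complex_measurableM.
  exact: complex_measurableX.
by apply: complex_measurableX; exact: complex_measurable_conj.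
Qed.

Lemma complex_measurable_alm_pos (X Y : nat -> T -> R) j :
  (forall j, measurable_fun setT (X j)) ->
  (forall j, measurable_fun setT (Y j)) ->
  complex_measurable (alm_pos X Y j).
Proof.
by move=> mX mY; rewrite /alm_pos; case: (j == 0); split => //=;
  exact: measurable_cst.
Qed.

End closure.

(** A real scalar is fixed by conjugation, so every factor contributes one [c], and the degrees add
    up to [2 * p]. Allowing two sample spaces covers both the dilation of a vector and the passage
    from [T] to [vec]. *)
Lemma moment_prod_scale (T T' : Type) (R : realType) k (u : nat -> T -> R[i])
    (u' : nat -> T' -> R[i]) (c : R) q0 (m q q' : 'I_k -> nat) p (t : T) (t' : T') :
  (q0 + \sum_(i < k) (q i + q' i) = 2 * p)%N ->
  u 0%N t = c%:C * u' 0%N t' -> (forall i, u (m i) t = c%:C * u' (m i) t') ->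
  moment_prod u q0 m q q' t = (c ^+ (2 * p))%:C * moment_prod u' q0 m q q' t'.
Proof.
move=> <- u0 um; rewrite /moment_prod u0 exprMn exprD rmorphM/= rmorphXn/=.
rewrite -!mulrA; congr (_ * _); rewrite [RHS]mulrCA; congr (_ * _).
rewrite -prodrXr rmorph_prod -big_split/=; apply: eq_bigr => i _.
have -> : Num.conj (u (m i) t) = c%:C * Num.conj (u' (m i) t').
  rewrite um; case: (u' (m i) t') => x y; apply/eqP.
  by rewrite eq_complex/= !mul0r !subr0 !addr0 mulrN !eqxx.
rewrite um !exprMn exprD rmorphM/= !rmorphXn/=.
by rewrite mulrACA.
Qed.

Lemma sum_normc_alm (T : Type) (R : realType) (X Y : nat -> T -> R) l t :
  \sum_(0 <= k < (2 * l + 1)%N)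
    ComplexField.Normc.normc (alm X Y (k%:Z - l%:Z) t) ^+ 2 =
  X 0%N t ^+ 2 + (\sum_(k < l) (X k.+1 t ^+ 2 + Y k.+1 t ^+ 2)) *+ 2.
Proof.
have normcE n : ComplexField.Normc.normc (alm_pos X Y n.+1 t) ^+ 2 =
    X n.+1 t ^+ 2 + Y n.+1 t ^+ 2.
  by rewrite /alm_pos/= sqr_sqrtr// addr_ge0// sqr_ge0.
have normc_opp n : ComplexField.Normc.normc (alm X Y (Negz n) t) ^+ 2 =
    X n.+1 t ^+ 2 + Y n.+1 t ^+ 2.
  rewrite -normcE /alm -signr_odd; case: (alm_pos X Y n.+1 t) => x y.
  by case: odd; rewrite ?expr1 ?expr0 ?mulN1r ?mul1r/= !sqrrN.
(* The first [l] indices are the negative orders, reversed below to match the positive ones; index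
   [l] is order 0. *)
rewrite (_ : (2 * l + 1 = l + l.+1)%N); last by lia.
rewrite big_mkord big_split_ord/= big_ord_recl/=.
rewrite (reindex_inj rev_ord_inj)/=.
rewrite (eq_bigr (fun i : 'I_l => X i.+1 t ^+ 2 + Y i.+1 t ^+ 2)); last first.
  move=> i _; rewrite -normc_opp; congr (ComplexField.Normc.normc (alm X Y _ t) ^+ 2).
  by have := ltn_ord i; lia.
rewrite addn0 subrr addrCA mulr2n; congr (_ + (_ + _)).
  by rewrite /alm/= /alm_pos/= expr0n addr0 sqrtr_sqr -normrX ger0_norm ?sqr_ge0.
apply: eq_bigr => i _; rewrite -normcE -[alm_pos X Y i.+1 t]/(alm X Y (Posz i.+1) t).
congr (ComplexField.Normc.normc (alm X Y _ t) ^+ 2).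
by rewrite /bump/=; lia.
Qed.

End complex_moments.

(** * The spherical harmonic coefficients as functions of a real vector *)

Section harmonic_coordinates.
Context (R : realType) (l : nat).
Local Notation I := ('I_l.+1 + 'I_l)%type.

(* The vector has [l] sine coordinates: the one of order [j >= 1] sits at index
   [j - 1].  Outside the range of [j] both coordinate maps are [0]. *)
Definition cosine_coord (j : nat) (x : vec I R) : R :=
  if insub j is Some i then x (inl i) else 0.

Definition sine_coord (j : nat) (x : vec I R) : R :=
  if insub j.-1 is Some i then x (inr i) else 0.

Lemma measurable_cosine_coord j : measurable_fun setT (cosine_coord j).
Proof.
by rewrite /cosine_coord; case: insub => [i|] //; exact: measurable_coord.
Qed.

Lemma measurable_sine_coord j : measurable_fun setT (sine_coord j).
Proof.
by rewrite /sine_coord; case: insub => [i|] //; exact: measurable_coord.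
Qed.

(** The body repeats the family of the independence hypothesis, so that this vector is convertible
    to the [V] of the inverse moment lemmas. *)
Definition harmonic_vec (T : Type) (X Y : nat -> T -> R) (t : T) : vec I R :=
  fun s => (match s with inl j => X j | inr j => Y j.+1 end) t.

(** Here [alm_pos] takes the space of vectors itself as sample space, which turns the monomial into
    a function of the Gaussian vector. *)
Lemma alm_pos_harmonic_vec (T : Type) (X Y : nat -> T -> R) (j : nat) (t : T) :
  (j <= l)%N ->
  alm_pos cosine_coord sine_coord j (harmonic_vec X Y t) = alm_pos X Y j t.
Proof.
move=> jl; rewrite /alm_pos /cosine_coord /sine_coord.
case: j jl => [|j] jl /=; first by rewrite insubT.
by rewrite (@insubT _ (fun i => i < l.+1)%N _ j.+1 jl)
  (@insubT _ (fun i => i < l)%N _ j jl).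
Qed.

Local Open Scope complex_scope.

Lemma alm_pos_scale (c : R) (j : nat) (x : vec I R) :
  alm_pos cosine_coord sine_coord j (fun i => c * x i) =
  c%:C * alm_pos cosine_coord sine_coord j x.
Proof.
have cE : cosine_coord j (fun i => c * x i) = c * cosine_coord j x.
  by rewrite /cosine_coord; case: insub => [i|]//; rewrite mulr0.
have sE : sine_coord j (fun i => c * x i) = c * sine_coord j x.
  by rewrite /sine_coord; case: insub => [i|]//; rewrite mulr0.
rewrite /alm_pos; case: eqP => [j0|_].
  by rewrite -j0 cE rmorphM.
apply/eqP; rewrite eq_complex/= cE sE !mul0r subr0 addr0.
by rewrite !eqxx.
Qed.

Definition harmonic_variance (Cl : R) (s : I) : R :=
  if s is inl (Ordinal 0 _) then Cl else Cl / 2.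

(** Orders [j] and [-j] contribute equally to [Chat]; this doubling is exactly the division by the
    variance [Cl / 2] in [sumsq]. *)
Lemma Chat_sumsq (T : Type) (Cl : R) (X Y : nat -> T -> R) (t : T) : 0 < Cl ->
  Chat l X Y t = (2 * l + 1)%:R^-1 *
    (Cl * sumsq (harmonic_variance Cl) (harmonic_vec X Y t)).
Proof.
move=> C0; rewrite /Chat sum_normc_alm; congr (_ * _).
rewrite /sumsq big_sumType/= big_ord_recl/=.
rewrite !mulrDr -addrA; congr (_ + _).
  by rewrite mulrC divfK ?gt_eqF.
rewrite -mulrDr -big_split/= mulr_sumr -sumrMnl; apply: eq_bigr => i _.
rewrite /bump/= add1n; field.
by rewrite gt_eqF.
Qed.

End harmonic_coordinates.

Lemma gfacE (R : realType) (l p : nat) :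
  gfac l p = (2 * l + 1)%:R ^+ p *
    \prod_(i < p) ((2 * l + 1) + 2 * i)%:R^-1 :> R.
Proof.
rewrite /gfac big_add1/= big_mkord big_split/= prodr_const card_ord; congr (_ * _).
apply: eq_bigr => i _; congr (_%:R^-1); lia.
Qed.


(** * Moments of the normalized coefficients *)

Section harmonic_moments.
Context (R : realType) (d : measure_display) (T : measurableType d).
Context (P : probability T R) (l : nat) (Cl : R) (X Y : nat -> T -> R).
Context (k : nat) (m : 'I_k -> nat) (q0 : nat) (q q' : 'I_k -> nat) (p : nat).
Hypotheses (Cl0 : 0 < Cl).
Hypothesis normalX0 : is_centered_normal P Cl (X 0%N).
Hypothesis normalX :
  forall j, (1 <= j <= l)%N -> is_centered_normal P (Cl / 2) (X j).
Hypothesis normalY :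
  forall j, (1 <= j <= l)%N -> is_centered_normal P (Cl / 2) (Y j).
Hypothesis indep : mutually_independent P
    (fun s : 'I_l.+1 + 'I_l =>
       match s with inl j => X j | inr j => Y j.+1 end).
Hypothesis ml : forall i, (1 <= m i <= l)%N.
Hypothesis q2p : (q0 + \sum_(i < k) (q i + q' i) = 2 * p)%N.

Local Open Scope complex_scope.

Let V := @harmonic_vec R l T X Y.

Let a : vec ('I_l.+1 + 'I_l)%type R -> R[i] :=
  moment_prod (alm_pos (@cosine_coord R l) (@sine_coord R l)) q0 m q q'.

(** Homogeneity with scalar [(Num.sqrt (r t))^-1]: the even degree [2 * p] removes the root. It
    serves for both normalizations, [r = Chat] and constant [r = Cl]. *)
Let moment_prod_div (r : T -> R) (t : T) : 0 <= r t ->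
  moment_prod (fun j t => alm X Y j%:Z t / (Num.sqrt (r t))%:C) q0 m q q' t =
  (r t ^- p)%:C * a (V t).
Proof.
move=> r0.
have uE j : (j <= l)%N -> alm X Y j%:Z t / (Num.sqrt (r t))%:C =
    ((Num.sqrt (r t))^-1)%:C *
      alm_pos (@cosine_coord R l) (@sine_coord R l) j (V t).
  by move=> jl; rewrite alm_pos_harmonic_vec// fmorphV mulrC.
rewrite (moment_prod_scale q2p (uE 0%N (leq0n l)) (fun i => uE (m i) _)).
  by rewrite exprVn exprM sqr_sqrtr.
by move=> i; case/andP: (ml i).
Qed.

(** [part] stands for the real or the imaginary part; real homogeneity and measurability suffice to
    reduce both to a real homogeneous function of the Gaussian vector. *)
Lemma expectation_harmonic_ratio (part : R[i] -> R) :
  (forall (r : R) z, part (r%:C * z) = r * part z) ->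
  (forall d' (T' : measurableType d') (f : T' -> R[i]), complex_measurable f ->
    measurable_fun setT (fun t => part (f t))) ->
  ('E_P[fun t => part (moment_prod
      (fun j t => (alm X Y j%:Z t / (Num.sqrt (Chat l X Y t))%:C)%R) q0 m q q' t)] =
   'E_P[fun t => part (moment_prod
      (fun j t => (alm X Y j%:Z t / (Num.sqrt Cl)%:C)%R) q0 m q q' t)] *
    (gfac l p)%:E)%E.
Proof.
move=> partZ mpart.
pose v := @harmonic_variance R l Cl.
have Cl20 : 0 < Cl / 2 by rewrite divr_gt0.
have v0 s : 0 < v s by case: s => [[[|j] jl]|j].
have normalF s : is_centered_normal P (v s)
    ((fun s : 'I_l.+1 + 'I_l => match s with inl j => X j | inr j => Y j.+1 end) s).
  case: s => [[j jl]|j]; last by apply: normalY; exact: ltn_ord.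
  by case: j jl => [|j] jl; [exact: normalX0|exact: normalX].
pose h x := part ((Cl ^- p)%:C * a x).
have mh : measurable_fun setT h.
  apply: mpart; apply: complex_measurableM; first by split; exact: measurable_cst.
  apply: complex_measurable_moment_prod => j; apply: complex_measurable_alm_pos => i.
    exact: measurable_cosine_coord.
  exact: measurable_sine_coord.
have hhom (c : R) x : 0 <= c -> h (fun i => c * x i) = c ^+ (2 * p) * h x.
  have aE : a (fun i => c * x i) = (c ^+ (2 * p))%:C * a x.
    by apply: (moment_prod_scale q2p) => [|i]; exact: alm_pos_scale.
  by move=> c0; rewrite /h aE mulrCA partZ.
pose N : R := (2 * l + 1)%:R.
have N0 : 0 < N by rewrite ltr0n addn1.
have cardI : #|{: 'I_l.+1 + 'I_l}| = (2 * l + 1)%N.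
  by rewrite card_sum !card_ord; lia.
(* Since [Chat = Cl * S / N], where [S] is the value of [sumsq], the factor [Chat ^- p] is
   [N ^+ p * Cl ^- p / S ^+ p]. The power of [Cl] is absorbed in [h], and [N ^+ p] becomes the
   numerator of [gfac]. *)
rewrite unlock; transitivity (\int[P]_t (N ^+ p *
    (h (V t) / sumsq v (V t) ^+ p))%:E)%E.
  apply: eq_integral => t _; congr EFin.
  have S0 := sumsq_ge0 v0 (V t).
  have CE := Chat_sumsq l X Y t Cl0.
  rewrite (moment_prod_div (r := Chat l X Y)); last first.
    by rewrite CE !mulr_ge0// ?invr_ge0 ltW.
  rewrite CE /h !partZ !exprMn exprVn !invfM invrK.
  rewrite -/v; ring.
rewrite (integral_inverse_moment indep normalF v0 _ _ mh hhom); last 2 first.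
- by rewrite cardI addn1.
- by rewrite exprn_gt0.
rewrite cardI gfacE muleC; congr (_ * _)%E.
apply: eq_integral => t _; congr EFin.
by rewrite (moment_prod_div (r := fun=> Cl))// ltW.
Qed.

End harmonic_moments.

Theorem theorem4p1 (R : realType) (d : measure_display) (T : measurableType d)
  (P : probability T R) (l : nat) (Cl : R) (X Y : nat -> T -> R)
  (k : nat) (m : 'I_k -> nat) (q0 : nat) (q q' : 'I_k -> nat) (p : nat) :
  (1 <= l)%N ->
  0 < Cl ->
  is_centered_normal P Cl (X 0%N) ->
  (forall j, (1 <= j <= l)%N -> is_centered_normal P (Cl / 2) (X j)) ->
  (forall j, (1 <= j <= l)%N -> is_centered_normal P (Cl / 2) (Y j)) ->
  mutually_independent P
    (fun s : 'I_l.+1 + 'I_l =>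
       match s with inl j => X j | inr j => Y j.+1 end) ->
  (forall i, 1 <= m i <= l)%N ->
  (forall i j : 'I_k, (i < j)%N -> (m i < m j)%N) ->
  (q0 + \sum_(i < k) (q i + q' i) = 2 * p)%N ->
  let u := fun (j : nat) (t : T) =>
    (alm X Y j%:Z t / (Num.sqrt Cl)%:C)%C in
  let uhat := fun (j : nat) (t : T) =>
    (alm X Y j%:Z t / (Num.sqrt (Chat l X Y t))%:C)%C in
  ('E_P[fun t => complex.Re (moment_prod uhat q0 m q q' t)] =
    ('E_P[fun t => complex.Re (moment_prod u q0 m q q' t)] * (gfac l p)%:E))%E
  /\
  ('E_P[fun t => complex.Im (moment_prod uhat q0 m q q' t)] =
    ('E_P[fun t => complex.Im (moment_prod u q0 m q q' t)] * (gfac l p)%:E))%E.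
Proof.
move=> _ Cl0 nX0 nX nY indep ml _ q2p u uhat.
split; apply: (expectation_harmonic_ratio Cl0 nX0 nX nY indep ml q2p).
- by move=> r [x y] /=; rewrite mul0r subr0.
- by move=> d' T' f [].
- by move=> r [x y] /=; rewrite mul0r addr0.
- by move=> d' T' f [].
Qed.
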